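(* If $\operatorname{non}(\mathcal{N})=\mathfrak{c}$, then $\mathbf{PN}'\neq\mathbf{UN}$.
   Context: $\operatorname{non}(\mathcal{N})$ is the minimal cardinality of a subset of the real line which is not of Lebesgue measure zero; $\mathfrak{c}=2^{\aleph_0}$. $\mathbf{UN}$ is the class of universally null sets: sets $A\subseteq 2^\omega$ that are null with respect to every finite diffused (i.e. vanishing on singletons) Borel measure on $2^\omega$. $2^\omega$ is viewed as a vector space over $\mathbb{Z}_2$; $A+t=\{a+t: a\in A\}$. Perfect set: a nonempty closed subset of $2^\omega$ without isolated points. For a perfect set $P$, let $T_P=\{x\restriction n: x\in P,n\in\omega\}$, and call $w\in T_P$ a branching point if $w^\frown 0,w^\frown 1\in T_P$; $\operatorname{Split}(P)$ is the set of branching points. The canonical order isomorphism $e_P:2^{<\omega}\to\operatorname{Split}(P)$ sends $\emptyset$ to the shortest branching point, and $w^\frown i$ to the shortest branching point extending $e_P(w)^\frown i$. The canonical homeomorphism $h_P:2^\omega\to P$ is $h_P(x)=\bigcup_n e_P(x\restriction n)$. Let $m$ be the standard product (Lebesgue) measure on $2^\omega$. The canonical measure on $P$ is $\mu_P(A)=m(h_P^{-1}[A])$ for $A\subseteq P$ with $h_P^{-1}[A]$ Lebesgue measurable; $A\subseteq P$ is $P$-null if $\mu_P(A)=0$. $\mathbf{PN}'$ (sets perfectly null in the transitive sense) is the class of sets $X\subseteq 2^\omega$ such that for every perfect set $P\subseteq 2^\omega$ there exists a $G_\delta$ set $G\supseteq X$ such that for every $t\in 2^\omega$ the set $(G+t)\cap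 P$ is $P$-null. *)

(* Defs.v *)
From HB Require Import structures.
From mathcomp Require Import all_boot all_order all_algebra.
From mathcomp Require Import all_classical all_reals all_analysis.
From mathcomp Require Import borel_hierarchy lra.
Set Implicit Arguments.
Unset Strict Implicit.
Unset Printing Implicit Defensive.
Import Order.TTheory GRing.Theory Num.Theory.
Import numFieldNormedType.Exports.

Local Open Scope classical_set_scope.
Local Open Scope ring_scope.

(* "non(N) = #|K|": K is equipotent with a non-null set of reals of least
   cardinality. *)
Definition non_null_card_eq (R : realType) (T : Type) (K : set T) : Prop :=
  exists A : set R,
    [/\ ~ lebesgue_measure.-negligible A,
        forall B : set R, ~ lebesgue_measure.-negligible B -> (A #<= B)%card &
        (A #= K)%card].

Definition translate (A : set cantor_space) (t : cantor_space) :
    set cantor_space :=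
  [set ((fun k => addb (a k) (t k)) : cantor_space) | a in A].

Definition restr (x : cantor_space) (n : nat) : seq bool := mkseq x n.

Definition cylinder (s : seq bool) : set cantor_space :=
  [set x | restr x (size s) = s].

(* The product measure m on 2^omega: the Caratheodory measure of the outer
   measure generated by m([s]) = 2^-|s|. *)
Section product_measure.
Local Open Scope ereal_scope.
Variable R : realType.

Definition cylinder_wt (s : seq bool) : \bar R := ((2^-1) ^+ size s)%:E.

Definition cylinder_cover (A : set cantor_space) : set (nat -> seq bool) :=
  [set s | A `<=` \bigcup_k cylinder (s k)].

Definition cantor_outer (A : set cantor_space) : \bar R :=
  ereal_inf [set \sum_(k <oo) cylinder_wt (s k) | s in cylinder_cover A].

Lemma cylinder_wt_ge0 s : 0 <= cylinder_wt s.
Proof. by rewrite lee_fin exprn_ge0// invr_ge0. Qed.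

Lemma cantor_outer_ge0 A : 0 <= cantor_outer A.
Proof.
apply: le_ereal_inf_tmp => _ [s _ <-].
by apply: nneseries_ge0 => *; exact: cylinder_wt_ge0.
Qed.

Lemma le_cantor_outer : {homo cantor_outer : A B / A `<=` B >-> A <= B}.
Proof.
move=> A B AB; apply/ereal_inf_le_tmp => x [s Bs <-].
by exists s => //; exact: subset_trans AB Bs.
Qed.

Lemma cantor_outer0 : cantor_outer set0 = 0.
Proof.
apply/eqP; rewrite eq_le cantor_outer_ge0 andbT.
apply/lee_addgt0Pr => _/posnumP[e]; rewrite add0e.
have [N hN] : exists N, ((2^-1) ^+ N <= e%:num :> R)%R.
  have h : (fun n => 2^-1 ^+ n : R)%R @ \oo --> (0 : R)%R.
    by apply: cvg_expr; rewrite ger0_norm ?invr_ge0// invf_lt1// ltr1n.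
  have /cvgrPdist_le /(_ e%:num) := h.
  case=> // N _ /(_ N (leqnn N)) /=.
  rewrite sub0r normrN ger0_norm ?exprn_ge0 ?invr_ge0// => ?.
  by exists N.
pose s k := nseq (N + k.+1) true.
apply: (@le_trans _ _ (\sum_(k <oo) cylinder_wt (s k))).
  by apply: ereal_inf_lbound; exists s => // ? [].
have sumE n : \sum_(0 <= k < n) cylinder_wt (s k) =
    (2^-1 ^+ N * (1 - 2^-1 ^+ n))%:E.
  elim: n => [|n IH]; first by rewrite big_geq// expr0 subrr mulr0.
  rewrite big_nat_recr//= IH /cylinder_wt size_nseq -EFinD; congr EFin.
  rewrite exprD -mulrDr; congr *%R.
  by rewrite exprS; lra.
apply: lime_le.
  by apply: is_cvg_nneseries => *; exact: cylinder_wt_ge0.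
apply: nearW => n; rewrite sumE lee_fin (le_trans _ hN)//.
by rewrite ler_piMr ?exprn_ge0 ?invr_ge0// gerBl exprn_ge0 ?invr_ge0.
Qed.

Lemma cantor_outer_sigma_subadditive : sigma_subadditive cantor_outer.
Proof.
move=> A; have [[i ioo]|] := pselect (exists i, cantor_outer (A i) = +oo).
  rewrite (eseries_pinfty _ _ ioo) ?leey// => n _.
  by rewrite -ltNye (lt_le_trans _ (cantor_outer_ge0 _)).
rewrite -forallNE => Aoo.
suff add2e (e : {posnum R}) : cantor_outer (\bigcup_n A n) <=
    \sum_(i <oo) cantor_outer (A i) + e%:num%:E.
  by apply/lee_addgt0Pr => _/posnumP[].
rewrite (le_trans _ (epsilon_trick _ _ _))//; last first.
  by move=> n; exact: cantor_outer_ge0.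
pose Q n (s : nat -> seq bool) := cylinder_cover (A n) s /\
  \sum_(k <oo) cylinder_wt (s k) <=
  cantor_outer (A n) + (e%:num / (2 ^ n.+1)%:R)%:E.
have [G PG] : {G : nat -> nat -> seq bool & forall n, Q n (G n)}.
  apply: (@choice _ _ Q) => n; rewrite /Q /cantor_outer.
  set S := (X in ereal_inf X); move infS : (ereal_inf S) => iS.
  case: iS infS => [r Sr|Soo|Soo].
  - have en1 : (0 < e%:num / (2 ^ n.+1)%:R)%R by [].
    have /(lb_ereal_inf_adherent en1) : ereal_inf S \is a fin_num by rewrite Sr.
    move=> [x [B AnB muBx] xS].
    by exists B; split => //; rewrite muBx -Sr; exact/ltW.
  - by have := Aoo n; rewrite /cantor_outer Soo.
  - suff : lbound S 0 by move/le_ereal_inf_tmp; rewrite Soo.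
    move=> /= _ [B AnB <-].
    by apply: nneseries_ge0 => *; exact: cylinder_wt_ge0.
pose w (p : nat * nat) := cylinder_wt (G p.1 p.2).
have w0 p : 0 <= w p by exact: cylinder_wt_ge0.
apply: (@le_trans _ _ (\esum_(p in setT) w p)).
  apply: ereal_inf_lbound => /=.
  have /card_esym/ppcard_eqP[f] := card_nat2.
  exists (fun k => G (f k).1 (f k).2).
    move=> t [i _ /((PG i).1) [j _ Gt]].
    by exists (f^-1%FUN (i, j)) => //=; rewrite invK ?inE.
  rewrite -(esum_pred_image w f xpredT) ?[fun=> _]set_true//.
  by rewrite image_eq.
rewrite (_ : esum _ _ =
    \sum_(i <oo) \sum_(j <oo) cylinder_wt (G i j)); last first.
  pose J : nat -> set (nat * nat) := fun i => [set (i, j) | j in setT].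
  rewrite (_ : setT = \bigcup_k J k); last first.
    by rewrite predeqE => -[a b]; split => // _; exists a => //; exists b.
  rewrite esum_bigcupT//=; last first.
    apply/trivIsetP => i j _ _ ij.
    rewrite predeqE => -[n m] /=; split => //= -[] [_] _ [<-{n} _].
    by move=> [m' _] [] /esym/eqP; rewrite (negbTE ij).
  rewrite -(image_id [set: nat]) -fun_true esum_pred_image//; last first.
    by move=> n _; exact: esum_ge0.
  apply: eq_eseriesr => /= j _.
  rewrite -(esum_pred_image w (pair j) predT)//=; last first.
    by move=> ? ? _ _; exact: (@can_inj _ _ _ snd).
  by congr esum; rewrite predeqE => -[a b]; split; move=> [i _ <-]; exists i.
apply: lee_nneseries => [i _ _|i _].
  by apply: nneseries_ge0 => *; exact: cylinder_wt_ge0.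
exact: (PG i).2.
Qed.

HB.instance Definition _ := isOuterMeasure.Build R cantor_space cantor_outer
  cantor_outer0 cantor_outer_ge0 le_cantor_outer
  cantor_outer_sigma_subadditive.

End product_measure.

Definition cantor_measurable (R : realType) : set (set cantor_space) :=
  (@cantor_outer R).-cara.-measurable.

Definition cantor_measure (R : realType) :
    set (caratheodory_type (@cantor_outer R)) -> \bar R := @cantor_outer R.

HB.instance Definition _ (R : realType) := isMeasure.Build _ _ _
  (@cantor_measure R)
  (@caratheodory_measure0 _ _ (@cantor_outer R))
  (@caratheodory_measure_ge0 _ _ (@cantor_outer R))
  (@caratheodory_measure_sigma_additive _ _ (@cantor_outer R)).

(* perfect_set allows the empty set. *)
Definition perfect (P : set cantor_space) : Prop :=
  P !=set0 /\ perfect_set P.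

Definition tree (P : set cantor_space) : set (seq bool) :=
  [set w | exists x n, P x /\ w = restr x n].

Definition Split (P : set cantor_space) : set (seq bool) :=
  [set w | [/\ tree P w, tree P (rcons w false) & tree P (rcons w true)]].

(* For perfect P and v in its tree, the set below is a singleton. *)
Definition shortest_split (P : set cantor_space) (v : seq bool) : seq bool :=
  xget [::] [set w | [/\ Split P w, prefix v w &
    forall u, Split P u -> prefix v u -> (size w <= size u)%N]].

Definition canon_iso (P : set cantor_space) (w : seq bool) : seq bool :=
  foldl (fun v i => shortest_split P (rcons v i)) (shortest_split P [::]) w.

(* A word is the finite function k |-> nth _ w k; the union of the words
   e_P(x|n) takes the value true at k iff one of them does. *)
Definition canon_homeo (P : set cantor_space) (x : cantor_space) :
    cantor_space :=
  fun k => `[< exists n, onth (canon_iso P (restr x n)) k = Some true >].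

Definition canon_measure (R : realType) (P A : set cantor_space) : \bar R :=
  @cantor_measure R (canon_homeo P @^-1` A).

Definition P_null (R : realType) (P A : set cantor_space) : Prop :=
  [/\ A `<=` P, cantor_measurable R (canon_homeo P @^-1` A) &
      canon_measure R P A = 0%E].

Definition cantor_borel := g_sigma_algebraType (@open cantor_space).

Definition UN (R : realType) : set (set cantor_space) :=
  [set A | forall mu : {finite_measure set cantor_borel -> \bar R},
     (forall x : cantor_borel, mu [set x] = 0%E) -> mu.-negligible A].

Definition PN' (R : realType) : set (set cantor_space) :=
  [set X | forall P : set cantor_space, perfect P ->
     exists G : set cantor_space,
       [/\ Gdelta G, X `<=` G &
           forall t : cantor_space, P_null R P (translate G t `&` P)]].

(* Main.v *)
Require Import Defs.
From mathcomp Require Import all_boot all_order all_algebra.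
From mathcomp Require Import all_classical all_reals all_analysis.
From mathcomp Require Import wochoice borel_hierarchy measurable_realfun.
From mathcomp Require Import ring lra.

(** If non(N) = c, some universally null set is not perfectly null in the
    transitive sense.  The set is indexed by a non-null set [A] of reals of
    cardinality c = non(N), and combines Grzegorek's construction of large
    universally null sets with a diagonalization.

    Order [A] so that every initial segment is smaller than [A]
    ([small_initial_segments]).  An initial segment is then Lebesgue null, so
    for each [a] in [A] the reals of [A] below [a] lie in a null G_delta set
    of reals; let [c a] be a code of it, a point of the Cantor space.  Any
    choice of points [x a] whose even bits spell [c a] gives a universally
    null set ([UN_of_covering_codes]): given a diffuse measure [mu], Fubini
    exchanges null sections ([null_sections_exchange]), so for
    Lebesgue-almost every [y] the set of those [x] that code a null set
    containing [y] is [mu]-null.  As [A] is not null, some [b] in [A] is such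
    a [y].  That set contains [x a] for all [a] above [b], and the [x a] with
    [a] below [b] form a set of size less than non(N), which is [mu]-null
    because the distribution function of [mu] carries [mu] to Lebesgue measure
    ([uniformized_null], [small_negligible]).

    The odd bits of [x a] remain free.  They range over the perfect set [P] of
    points with zero even bits, which is not [P]-null
    ([exists_outside_P_null]).  There are at most as many G_delta sets as
    elements of [A], so let [G a] run through all of them, let [t a] carry the
    bits [c a] at even places and zeros at odd ones, and set [x a = p a + t a]
    with [p a] in [P] chosen outside [G a + t a] whenever [G a + t a] meets [P]
    in a [P]-null set.  If [G a] contains the whole set, then it contains
    [x a], so [G a + t a] contains [p a], and hence its trace on [P] is not
    [P]-null. *)

Set Implicit Arguments.
Unset Strict Implicit.
Unset Printing Implicit Defensive.
Import Order.TTheory GRing.Theory Num.Theory.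
Import numFieldNormedType.Exports.

Local Open Scope classical_set_scope.
Local Open Scope ring_scope.

(** * Orders with small initial segments *)

(** If a well-order has a segment as large as [A], an injection [f] of [A]
    into the least such segment pulls the order back to one all of whose
    segments are small. *)
Lemma small_initial_segments (T : pointedType) (A : set T) :
  exists lt : T -> T -> Prop,
    (forall a b, A a -> A b -> a <> b -> lt a b \/ lt b a) /\
    (forall b, A b -> ~ (A #<= [set a | A a /\ lt a b])%card).
Proof.
have [r wo_r] := well_ordering_principle T.
have least (P : set T) : P !=set0 -> exists2 m, P m & forall x, P x -> r m x.
  move=> [x Px]; have [|m [[+ lem] _]] := wo_r [pred y | `[< P y >]].
    by exists x; rewrite inE.
  rewrite inE => Pm; exists m => // y Py.
  by apply: lem; rewrite inE.
have tot a b : r a b \/ r b a.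
  have [|m [->|->] mP] := least [set a; b]; first by exists a; left.
    by left; apply: mP; right.
  by right; apply: mP; left.
have anti a b : r a b -> r b a -> a = b.
  move=> ab ba; have [|m [_ um]] := wo_r (pred2 a b).
    by exists a; rewrite !inE eqxx.
  have rxx x : r x x by have [] := tot x x.
  (* Both a and b are least elements of {a, b}. *)
  by rewrite -(um a) ?(um b)//; split; rewrite ?inE ?eqxx ?orbT// => x;
    rewrite !inE => /orP[]/eqP->.
pose seg b := [set a | A a /\ ~ r b a].
have [noseg|] := pselect (forall b, A b -> ~ (A #<= seg b)%card).
  exists (fun a b => ~ r b a); split => // a b _ _ ab.
  by have [rab|rba] := tot a b; [left => rba|right => rab]; apply/ab/anti.
move=> /existsNP[b /not_implyP[Ab /contrapT bigb]].
have [|c [Ac bigc] cmin] := least [set b | A b /\ (A #<= seg b)%card].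
  by exists b.
have /pcard_leP[f] := bigc.
exists (fun a b => ~ r (f b) (f a)); split => [x y Ax Ay xy|x Ax bigx].
  have [rab|rba] := tot (f x) (f y); [left => rba|right => rab]; apply: xy;
    by apply: (@inj _ _ _ f); rewrite ?inE//; apply: anti.
have [Afx] : seg c (f x) by apply: funS.
apply; apply: cmin; split => //; apply: (card_le_trans bigx).
set S := [set a | _]; have SA : S `<=` A by move=> a [].
apply: (@card_le_trans _ _ _ (f @` S)); first by rewrite card_le_image.
apply: subset_card_le => _ [a [Aa na] <-]; split => //.
by have [] : seg c (f a) by apply: funS.
Qed.

(** * Codes for G_delta sets *)

Lemma nth_restr (x : cantor_space) n k :
  (k < n)%N -> nth false (restr x n) k = x k.
Proof. by move=> kn; rewrite nth_mkseq. Qed.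

Lemma cylinder_restrP (x y : cantor_space) n :
  cylinder (restr x n) y <-> forall k, (k < n)%N -> y k = x k.
Proof.
rewrite /cylinder /= size_mkseq; split => [yx k kn|yx].
  by rewrite -(nth_restr y kn) yx nth_restr.
apply: (@eq_from_nth _ false) => [|k]; rewrite ?size_mkseq// => kn.
by rewrite !nth_restr// yx.
Qed.

(** The cylinders around [x] generate a filter that converges to [x], since
    convergence in the product topology is coordinatewise. *)
Lemma cylinder_basis (x : cantor_space) (U : set cantor_space) :
  nbhs x U -> exists n, cylinder (restr x n) `<=` U.
Proof.
pose F := filter_from [set: nat] (fun n => cylinder (restr x n)).
have FF : Filter F.
  apply: filter_from_filter; first by exists 0%N.
  move=> i j _ _; exists (maxn i j) => // y /cylinder_restrP yx.
  by split; apply/cylinder_restrP => k kn; apply: yx;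
    rewrite leq_max kn ?orbT.
suff /[apply] -[n _ nU] : F --> x by exists n.
apply/cvg_sup => i V [_ [[W oW <-] Wx WV]].
exists i.+1 => // y /cylinder_restrP yx; apply: WV.
by rewrite /= yx.
Qed.

Lemma continuous_bit k : continuous (fun x : cantor_space => x k).
Proof. exact: (@proj_continuous nat (fun=> bool) k). Qed.

(** When [B] enumerates a base of open sets, [c] codes a sequence of open sets,
    the [n]-th being the union of the [B i] with [c] true at the pair
    [(n, i)], and hence the G_delta set that is their intersection.  Infinite
    binary sequences thus code all G_delta sets, and membership in the coded
    set is a countable Boolean combination of conditions on single bits. *)
Definition decode (T : Type) (I : countType) (B : I -> set T)
    (c : nat -> bool) : set T :=
  \bigcap_n \bigcup_(i in [set i : I | c (@pickle (nat * I)%type (n, i))]) B i.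

Lemma decode_surj (T : topologicalType) (I : countType) (B : I -> set T)
    (F : nat -> set T) :
  (forall U x, open U -> U x -> exists2 i, B i x & B i `<=` U) ->
  (forall n, open (F n)) -> exists c, \bigcap_n F n = decode B c.
Proof.
move=> Bbase oF.
pose c k := if @unpickle (nat * I)%type k is Some p
            then `[< B p.2 `<=` F p.1 >] else false.
exists c; apply/seteqP; split => x Fx n _.
  have [i Bix BiF] := Bbase _ x (oF n) (Fx n Logic.I).
  by exists i => //=; rewrite /c pickleK; apply/asboolP.
by have [i /=] := Fx n Logic.I; rewrite /c pickleK => /asboolP; apply.
Qed.

Lemma cylinder_open_basis (U : set cantor_space) x :
  open U -> U x -> exists2 s, cylinder s x & cylinder s `<=` U.
Proof.
move=> oU Ux; have [n nU] : exists n, cylinder (restr x n) `<=` U.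
  by apply: cylinder_basis; apply: open_nbhs_nbhs.
by exists (restr x n) => //; apply/cylinder_restrP.
Qed.

Definition rat_itv (R : realType) (q : rat * rat) : set R :=
  `]ratr q.1, ratr q.2[%classic.

Lemma rat_itv_open_basis (R : realType) (U : set R) x :
  open U -> U x -> exists2 q, @rat_itv R q x & @rat_itv R q `<=` U.
Proof.
move=> oU Ux.
have /nbhs_ballP[e /= e0 eU] : nbhs x U by exact: open_nbhs_nbhs.
have [p pI] : exists p, ratr p \in `]x - e, x[.
  by apply: rat_in_itvoo; rewrite ltrBlDr ltrDl.
have [q qI] : exists q, ratr q \in `]x, x + e[.
  by apply: rat_in_itvoo; rewrite ltrDl.
exists (p, q); rewrite /rat_itv set_itvE/=.
  by rewrite (itvP pI) (itvP qI).
move=> y /= /andP[py yq]; apply: eU.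
move: pI qI; rewrite !in_itv/= => /andP[? ?] /andP[? ?].
by rewrite /ball/= ltr_distlC; apply/andP; split; lra.
Qed.

(** * Transporting a diffuse probability to Lebesgue measure *)

Section integral_transform.
Context d (T : measurableType d) (R : realType) (P : probability T R).
Variable X : {RV P >-> R}.
Hypothesis diffuse : forall r, P (X @^-1` [set r]) = 0%E.

Definition fcdf (r : R) : R := fine (cdf X r).

Lemma fcdfE r : (fcdf r)%:E = P (X @^-1` `]-oo, r]).
Proof. by rewrite /fcdf fineK ?fin_num_measure//. Qed.

Lemma fcdf_nondecreasing : {homo fcdf : x y / x <= y}.
Proof.
by move=> x y xy; rewrite -lee_fin !fcdfE le_measure ?inE//;
  [exact: measurable_funPTI..|apply: preimage_subset; exact: subset_itvl].
Qed.

Lemma measurable_fcdf : measurable_fun setT fcdf.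
Proof. by apply: nondecreasing_measurable => //; exact: fcdf_nondecreasing. Qed.

(** An intermediate value property: the value [c] is taken at the infimum of
    [{r | c <= fcdf r}].  Right continuity gives one inequality there; the
    other is left continuity, where diffuseness enters. *)
Lemma fcdf_surj c : 0 < c -> c < 1 -> exists r, fcdf r = c.
Proof.
move=> c0 c1; pose S := [set r | c <= fcdf r].
(* S is nonempty and bounded below by the limits 1 and 0 at infinity. *)
have [b Sb] : S !=set0.
  have /fine_cvg/cvgr_gt/(_ _ c1) := cvg_cdfy1 X.
  move=> [M [_ HM]]; exists (M + 1); apply: ltW; apply: HM.
  by rewrite ltrDl.
have [m Sm] : exists m, lbound S m.
  have /fine_cvg/cvgr_lt/(_ _ c0) := cvg_cdfNy0 X.
  move=> [M [_ HM]]; exists (M - 1) => s; rewrite /S /= leNgt => /negP ns.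
  rewrite leNgt; apply/negP => sM; apply: ns.
  by apply: HM; rewrite (lt_trans sM)// ltrBlDr ltrDl.
have infS : has_inf S by split; [exists b|exists m].
exists (inf S); apply/eqP; rewrite eq_le; apply/andP; split; last first.
  rewrite leNgt; apply/negP => Fc.
  have : cdf X x @[x --> (inf S)^'+] --> (fine (cdf X (inf S)))%:E.
    by rewrite fineK ?fin_num_measure//; exact: cdf_right_continuous.
  move=> /fine_cvg/cvgr_lt/(_ _ Fc) [e /= e0 He].
  have [s Ss se] := inf_adherent e0 infS.
  have := ge_inf infS.2 Ss; rewrite le_eqVlt => /predU1P[sE|infs].
    by move: Ss; rewrite /S /= -sE leNgt Fc.
  suff : fcdf s < c by rewrite ltNge; move: Ss; rewrite /S/= => ->.
  by apply: He => //=; rewrite ltr0_norm ?subr_lt0//; lra.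
rewrite leNgt; apply/negP => Fc.
(* The masses of the half-open intervals shrinking to {inf S} tend to 0. *)
pose D n := X @^-1` `]inf S - n.+1%:R^-1, inf S].
have D0 : P (D n) @[n --> \oo] --> 0%E.
  rewrite -(diffuse (inf S)) set1_bigcap_oc preimage_bigcap.
  apply: nonincreasing_cvg_mu => [|n||n k nk].
  - by rewrite -ge0_fin_numE// fin_num_measure//; exact: measurable_funPTI.
  - exact: measurable_funPTI.
  - by apply: bigcap_measurable => // ? _; exact: measurable_funPTI.
  - apply/subsetPset; apply: preimage_subset; apply: subset_itvr.
    by rewrite bnd_simp lerD2l lerN2 lef_pV2 ?posrE// ler_nat.
have /fine_cvg/cvgr_lt/(_ (fcdf (inf S) - c)) := D0.
rewrite subr_gt0 => /(_ Fc) [n _ /(_ n (leqnn n)) /= Dn].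
have n0 : 0 < n.+1%:R^-1 :> R by rewrite invr_gt0 ltr0n.
have : ~ S (inf S - n.+1%:R^-1).
  by move=> /(ge_inf infS.2); move: (_^-1) n0 => e n0; lra.
rewrite /S /= leNgt => /negP; rewrite negbK; apply/negP; rewrite -leNgt.
have : (fcdf (inf S))%:E =
    (fcdf (inf S - n.+1%:R^-1))%:E + P (D n).
  rewrite !fcdfE -measureU//=; [|exact: measurable_funPTI..|].
    rewrite -preimage_setU; congr (P (_ @^-1` _)).
    apply/seteqP; split => x /=; rewrite !in_itv/=.
      by move=> ->; rewrite andbT; case: (leP x); [left|right].
    case=> [/le_trans|/andP[]//]; apply.
    by rewrite gerBl invr_ge0 ler0n.
  rewrite -preimage_setI -[RHS](preimage_set0 X); congr (_ @^-1` _).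
  apply/seteqP; split => x //=; rewrite !in_itv/= => -[xl /andP[lx _]].
  by move: (lt_le_trans lx xl); rewrite ltxx.
rewrite -[P (D n)]fineK ?fin_num_measure//; last exact: measurable_funPTI.
by rewrite -EFinD => -[]; move: Dn; lra.
Qed.

(** The probability integral transform: composed with its own distribution
    function, a variable without atoms is uniformly distributed on the unit
    interval. *)
Definition uniformized (t : T) : R := fcdf (X t).

Lemma measurable_uniformized : measurable_fun setT uniformized.
Proof. exact: (measurableT_comp measurable_fcdf (measurable_funPT X)). Qed.

Lemma uniformized_preimage (B : set R) :
  measurable B -> measurable (uniformized @^-1` B).
Proof.
by move=> mB; rewrite -[_ @^-1` _]setTI; exact: measurable_uniformized.
Qed.

Lemma uniformized_lt c : 0 < c -> (P (uniformized @^-1` `]-oo, c[) <= c%:E)%E.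
Proof.
move=> c0; have [c1|c1] := ltP c 1; last first.
  apply: le_trans (probability_le1 P _) _; last by rewrite lee_fin.
  exact: uniformized_preimage.
have [r rc] := fcdf_surj c0 c1.
rewrite -[in leRHS]rc fcdfE le_measure ?inE//;
  [exact: uniformized_preimage|exact: measurable_funPTI|].
move=> t /=; rewrite !in_itv/= => Gc; rewrite leNgt; apply/negP => rt.
by have := fcdf_nondecreasing (ltW rt); rewrite rc leNgt => /negP; apply.
Qed.

Lemma uniformized_le c : c < 1 -> (c%:E <= P (uniformized @^-1` `]-oo, c]))%E.
Proof.
move=> c1; have [c0|c0] := ltP 0 c; last first.
  by apply: le_trans (measure_ge0 P _); rewrite lee_fin.
have [r rc] := fcdf_surj c0 c1.
rewrite -[in leLHS]rc fcdfE le_measure ?inE//;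
  [exact: measurable_funPTI|exact: uniformized_preimage|].
by move=> t /=; rewrite !in_itv/= => tr; rewrite -rc fcdf_nondecreasing.
Qed.

(** Unless it is empty, the event is [uniformized < b] minus
    [uniformized <= a], of probability at most [b] and at least [a]
    respectively. *)
Lemma uniformized_itv a b :
  (P (uniformized @^-1` `]a, b[) <= lebesgue_measure `]a, b[)%E.
Proof.
have [->|/set0P[t /=]] := eqVneq (uniformized @^-1` `]a, b[) set0.
  by rewrite measure0.
rewrite in_itv/= => /andP[at_ tb].
rewrite lebesgue_measure_itv/= lte_fin (lt_trans at_ tb).
have G0 : 0 <= uniformized t by rewrite -lee_fin fcdfE.
have G1 : uniformized t <= 1.
  rewrite -lee_fin fcdfE; apply: probability_le1; exact: measurable_funPTI.
have -> : uniformized @^-1` `]a, b[ =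
    uniformized @^-1` `]-oo, b[ `\` uniformized @^-1` `]-oo, a].
  apply/seteqP; split => s /=; rewrite !in_itv/=.
    by move=> /andP[a_s ->]; split => //; apply/negP; rewrite -ltNge.
  by move=> [-> /negP]; rewrite -ltNge => ->.
rewrite measureD; [|exact: uniformized_preimage..|].
  rewrite setIidr; last first.
    move=> s /=; rewrite !in_itv/= => /le_lt_trans; apply.
    exact: lt_trans at_ tb.
  rewrite -EFinB EFinB; apply: leeB.
    by apply: uniformized_lt; exact: le_lt_trans G0 tb.
  by apply: uniformized_le; exact: lt_le_trans at_ G1.
by rewrite -ge0_fin_numE// fin_num_measure//; exact: uniformized_preimage.
Qed.

(** A covering of [B] by open intervals of small total length pulls back to a
    covering by events of small total probability. *)
Lemma uniformized_null (B : set R) : lebesgue_measure.-negligible B ->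
  P.-negligible (uniformized @^-1` B).
Proof.
move=> [C [mC C0 BC]]; exists (uniformized @^-1` C); split => //.
- exact: uniformized_preimage.
- apply/eqP; rewrite eq_le measure_ge0 andbT.
  apply/lee_addgt0Pr => e e0; rewrite add0e.
  have C0' : ((wlength idfun)^*%mu C = 0 :> \bar R)%E.
    by apply/negligible_outer_measure; exists C; split.
  have [_ [F [Fitv CF] <- /ltW Fe]] : exists2 x,
      [set (\sum_(k <oo) wlength idfun (F k))%E | F in open_itv_cover C] x &
      (x < e%:E)%E.
    apply: ereal_inf_lt.
    by rewrite -outer_measure_open_itv_cover C0' lte_fin.
  apply: le_trans Fe.
  apply: le_trans (_ : _ <= \sum_(k <oo) P (uniformized @^-1` F k))%E _.
    apply: measure_sigma_subadditive => //.
    - move=> k; apply: uniformized_preimage.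
      by have [ab ->] := Fitv k; exact: measurable_itv.
    - exact: uniformized_preimage.
    - by move=> t /CF[k _ Fk]; exists k.
  apply: lee_nneseries => // k _.
  have [[a b] -> ] := Fitv k.
  apply: le_trans (uniformized_itv _ _) _.
  by rewrite wlength_itv lebesgue_measure_itv.
- by move=> t; apply: BC.
Qed.

End integral_transform.

(** * Diffuse measures on the Cantor space *)

Lemma measurable_bit k : measurable ([set x | x k] : set cantor_borel).
Proof.
suff : open ((fun x : cantor_space => x k) @^-1` [set true]).
  exact: sub_sigma_algebra.
by apply: open_comp => [x _|]; [exact: continuous_bit|exact: discrete_open].
Qed.

(** An injection of the Cantor space into the reals: in base 3 with digits 0
    and 1, the tail of an expansion is at most half of the preceding unit, so
    no value is taken twice. *)
Section ternary.
Variable R : realType.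
Implicit Types x : cantor_space.

Definition ternary_psum x n : R := \sum_(k < n) (x k)%:R * 3^-1 ^+ k.

Definition ternary x : R := limn (ternary_psum x).

Definition tail x : cantor_space := fun k => x k.+1.

Lemma ternary_psum_ge0 x n : 0 <= ternary_psum x n.
Proof. by apply: sumr_ge0 => k _; rewrite mulr_ge0// exprn_ge0// invr_ge0. Qed.

Lemma ternary_psum_rec x n :
  ternary_psum x n.+1 = (x 0%N)%:R + 3^-1 * ternary_psum (tail x) n.
Proof.
rewrite /ternary_psum big_ord_recl expr0 mulr1; congr +%R.
by rewrite mulr_sumr; apply: eq_bigr => k _; rewrite exprS mulrCA.
Qed.

Lemma ternary_psum_le x n : ternary_psum x n <= 3 / 2.
Proof.
elim: n x => [|n IH] x; first by rewrite /ternary_psum big_ord0; lra.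
rewrite ternary_psum_rec; have := IH (tail x).
have := ternary_psum_ge0 (tail x) n.
by case: (x 0%N) => /=; lra.
Qed.

Lemma ternary_cvg x : ternary_psum x @ \oo --> ternary x.
Proof.
apply: nondecreasing_is_cvgn.
  apply/nondecreasing_seqP => n; rewrite /ternary_psum big_ord_recr/= lerDl.
  by rewrite mulr_ge0// exprn_ge0// invr_ge0.
by exists (3 / 2) => _ [n _ <-]; exact: ternary_psum_le.
Qed.

Lemma ternary_ge0 x : 0 <= ternary x.
Proof.
apply: limr_ge; first exact: (cvgP _ (@ternary_cvg x)).
by apply: nearW => n; exact: ternary_psum_ge0.
Qed.

Lemma ternary_le x : ternary x <= 3 / 2.
Proof.
apply: limr_le; first exact: (cvgP _ (@ternary_cvg x)).
by apply: nearW => n; exact: ternary_psum_le.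
Qed.

Lemma ternary_rec x : ternary x = (x 0%N)%:R + 3^-1 * ternary (tail x).
Proof.
have : (fun n => ternary_psum x n.+1) @ \oo --> ternary x.
  by rewrite (cvg_shiftS (ternary_psum x)); exact: ternary_cvg.
have : (fun n => ternary_psum x n.+1) @ \oo -->
    (x 0%N)%:R + 3^-1 * ternary (tail x).
  under eq_fun do rewrite ternary_psum_rec.
  by apply: cvgD; [exact: cvg_cst|apply: cvgMr; exact: ternary_cvg].
by move=> rhs lhs; apply: (cvg_unique _ lhs rhs).
Qed.

Lemma ternary_inj : injective ternary.
Proof.
(* The self-similarity reduces the k-th bit to the first bit, which the value
   determines: it is at least 1 if the bit is set and at most 1/2 otherwise. *)
suff : forall k x y, ternary x = ternary y -> x k = y k.
  by move=> H x y xy; apply/funext => k; exact: H.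
have head x y : ternary x = ternary y ->
    x 0%N = y 0%N /\ ternary (tail x) = ternary (tail y).
  rewrite (ternary_rec x) (ternary_rec y).
  have := ternary_ge0 (tail x); have := ternary_le (tail x).
  have := ternary_ge0 (tail y); have := ternary_le (tail y).
  by case: (x 0%N); case: (y 0%N) => /=; split => //; lra.
by elim=> [|k IH] x y /head[] // _ /IH.
Qed.

Lemma measurable_ternary : measurable_fun setT (ternary : cantor_borel -> R).
Proof.
apply: (@measurable_fun_cvg _ cantor_borel R setT
  (fun n x => ternary_psum x n) ternary); last first.
  by move=> x _; exact: ternary_cvg.
move=> n; apply: measurable_sum => k; apply: measurable_funM => //.
have -> : (fun x : cantor_borel => (x k)%:R : R) =
    \1_[set x : cantor_borel | x k].
  apply/funext => x; rewrite indicE.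
  by congr ((nat_of_bool _)%:R); apply/idP/idP; rewrite inE.
by apply: measurable_indic; exact: (measurable_bit k).
Qed.

End ternary.

(** The measure is normalized to a probability and [g] is the integral
    transform of the ternary injection, whose fibres are singletons or empty,
    hence null. *)
Lemma diffuse_to_lebesgue (R : realType)
    (mu : {finite_measure set cantor_borel -> \bar R}) :
  (forall x : cantor_borel, mu [set x] = 0%E) ->
  exists g : cantor_borel -> R, forall B,
    lebesgue_measure.-negligible B -> mu.-negligible (g @^-1` B).
Proof.
move=> mu_diffuse; have [mu0|mu0] := eqVneq (mu setT) 0%E.
  by exists (fun=> 0) => B _; exists setT; split.
pose P : probability _ R := mnormalize mu (dirac (point : cantor_borel)).
have PE A : P A = (mu A * ((fine (mu setT))^-1)%:E)%E.
  rewrite /P /= /mnormalize (negbTE mu0)/=.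
  have := fin_num_measure mu _ measurableT.
  by rewrite fin_numE => /andP[_ /negbTE ->].
pose X : {RV P >-> R} := mfun_Sub (mem_set (@measurable_ternary R)).
have Pdiffuse r : P (X @^-1` [set r]) = 0%E.
  rewrite PE; have [->|/set0P[x /= xr]] := eqVneq (X @^-1` [set r]) set0.
    by rewrite measure0 mul0e.
  suff -> : X @^-1` [set r] = [set x] by rewrite mu_diffuse mul0e.
  apply/seteqP; split => [y /= yr|_ -> //]; apply: (@ternary_inj R).
  exact: (etrans yr (esym xr)).
exists (uniformized X) => B /(uniformized_null Pdiffuse)[C [mC C0 BC]].
exists C; split => //; move: C0; rewrite PE => /eqP.
rewrite mule_eq0 => /orP[/eqP//|].
rewrite eqe invr_eq0 fine_eq0 ?(negbTE mu0)//.
exact: fin_num_measure.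
Qed.

(** * Universally null sets from codes of null sets *)

(** By Fubini: the part of [D] above the [x] with null section is null for
    the product measure, so almost all its sections in the other direction
    are null. *)
Lemma null_sections_exchange d1 d2 (T1 : measurableType d1)
    (T2 : measurableType d2) (R : realType)
    (m1 : {finite_measure set T1 -> \bar R})
    (m2 : {sigma_finite_measure set T2 -> \bar R}) (D : set (T1 * T2)) :
  measurable D ->
  {ae m2, forall y, m1.-negligible
    [set x | m2 (xsection D x) = 0%E /\ D (x, y)]}.
Proof.
move=> mD; pose S := [set x | m2 (xsection D x) = 0%E].
have mS : measurable S.
  rewrite (_ : S = (m2 \o xsection D) @^-1` [set 0%E]); last by [].
  by rewrite -[_ @^-1` _]setTI; exact: measurable_fun_xsection.
pose D' := D `&` (S `*` setT).
have mD' : measurable D' by apply: measurableI => //; exact: measurableX.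
have D'0 : (m1 \x m2)%E D' = 0%E.
  apply: integral0_eq => x _ /=.
  have [Sx|Sx] := pselect (S x).
    apply/eqP; rewrite -measure_le0 -[leRHS]Sx le_measure ?inE//.
    - exact: measurable_xsection.
    - exact: measurable_xsection.
    - by apply: le_xsection => z [].
  rewrite (_ : xsection D' x = set0) ?measure0//.
  by apply/seteqP; split => // y; rewrite /xsection/= inE => -[_ []].
have int0 : (\int[m2]_y (m1 (ysection D' y)) = 0)%E.
  rewrite -D'0; apply/esym.
  by rewrite (@product_measure_unique _ _ _ _ _ m1 m2 (m1 \x^ m2)%E)// => *;
    exact: product_measure2E.
have mf : measurable_fun setT (m1 \o ysection D').
  exact: measurable_fun_ysection.
have /(ae_eq_integral_abs m2 measurableT mf) :
    (\int[m2]_y `| (m1 \o ysection D') y | = 0)%E.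
  by rewrite -[RHS]int0; apply: eq_integral => y _; rewrite gee0_abs.
apply: filterS => y /(_ Logic.I) /= m0.
exists (ysection D' y); split => //; first exact: measurable_ysection.
by move=> x /= [Sx Dxy]; rewrite /ysection/= inE; split.
Qed.

Lemma measurable_singleton (x : cantor_space) :
  measurable ([set x] : set cantor_borel).
Proof.
suff : open (~` [set x]).
  move=> /(@sub_sigma_algebra _ setT) mC; rewrite -(setCK [set x]).
  exact: (@measurableC _ cantor_borel).
apply: closed_openC; apply: accessible_closed_set1.
exact/hausdorff_accessible/cantor_space_hausdorff.
Qed.

(** The map [g] of [diffuse_to_lebesgue] sends [E] to a set of reals of no
    greater cardinality, which is Lebesgue null; [E] lies in its preimage. *)
Lemma small_negligible (R : realType) (A : set R) (E : set cantor_space)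
    (mu : {finite_measure set cantor_borel -> \bar R}) :
  (forall B : set R, ~ lebesgue_measure.-negligible B -> (A #<= B)%card) ->
  (forall x : cantor_borel, mu [set x] = 0%E) ->
  ~ (A #<= E)%card -> mu.-negligible E.
Proof.
move=> Amin /diffuse_to_lebesgue[g gnull] smallE.
apply: (@negligibleS _ _ _ mu (g @^-1` (g @` E))); first exact: preimage_image.
apply: gnull; apply: contrapT => /Amin AgE; apply: smallE.
exact: card_le_trans AgE (card_image_le _ _).
Qed.

Definition evens (x : cantor_space) : nat -> bool := fun k => x k.*2.

Lemma measurable_decode_evens (R : realType) :
  measurable
    [set z : cantor_borel * R | decode (@rat_itv R) (evens z.1) z.2].
Proof.
rewrite (_ : [set _ | _] = \bigcap_n \bigcup_q
    ([set x : cantor_borel | x (@pickle (nat * (rat * rat))%type (n, q)).*2]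
       `*` @rat_itv R q)).
  apply: bigcapT_measurable => n; apply: countable_bigcupT_measurable => // q.
  apply: measurableX; first exact: (measurable_bit _).
  exact: measurable_itv.
apply/seteqP; split => -[x y] /= Dxy n _.
  by have [q /= xq yq] := Dxy n Logic.I; exists q.
by have [q _ [/= xq yq]] := Dxy n Logic.I; exists q.
Qed.

(** Grzegorek's argument.  Since [A] is not null, some [b] in [A] satisfies the
    conclusion of [null_sections_exchange]; it disposes of all [x a] with [a]
    above [b], because they code null sets that contain [b].  The [x a] with
    [a] below [b] are too few to matter, and [x b] is a single point. *)
Lemma UN_of_covering_codes (R : realType) (A : set R) (lt : R -> R -> Prop)
    (x : R -> cantor_space) :
  ~ lebesgue_measure.-negligible A ->
  (forall B : set R, ~ lebesgue_measure.-negligible B -> (A #<= B)%card) ->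
  (forall a b, A a -> A b -> a <> b -> lt a b \/ lt b a) ->
  (forall b, A b -> ~ (A #<= [set a | A a /\ lt a b])%card) ->
  (forall a, A a ->
    lebesgue_measure (decode (@rat_itv R) (evens (x a))) = 0%E) ->
  (forall a b, A a -> A b -> lt b a -> decode (@rat_itv R) (evens (x a)) b) ->
  UN R (x @` A).
Proof.
move=> Anull Amin tri seg xnull xcov mu mu_diffuse.
pose D := [set z : cantor_borel * measurableTypeR R |
  decode (@rat_itv R) (evens z.1) z.2].
have := @null_sections_exchange _ _ _ _ R mu lebesgue_measure D
  (@measurable_decode_evens R).
set Q := (fun y : R => _) => aeQ.
have [b Ab Qb] : exists2 b, A b & Q b.
  apply: contrapT => nQ; apply: Anull; apply: negligibleS aeQ => b Ab /=.
  by move=> Qb; apply: nQ; exists b.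
have Eb : mu.-negligible (x @` [set a | A a /\ lt a b]).
  apply: (small_negligible Amin) => // big; apply: (seg b Ab).
  exact: card_le_trans big (card_image_le _ _).
have xb : mu.-negligible [set x b].
  by apply/negligibleP; [exact: measurable_singleton|exact: mu_diffuse].
apply: negligibleS (negligibleU Qb (negligibleU Eb xb)) => _ [a Aa <-].
have [->|ab] := pselect (a = b); first by right; right.
have [lab|lba] := tri a b Aa Ab ab; first by right; left; exists a.
left; split; last exact: xcov.
rewrite -[RHS](xnull a Aa); congr (lebesgue_measure _).
by apply/seteqP; split => y; rewrite /xsection /= inE.
Qed.

(** * The product measure does not vanish *)

Section full_measure.
Local Open Scope ereal_scope.
Variable R : realType.

(** The share of the cylinder of [s] that is covered by the cylinder of [u]. *)
Fixpoint relative_wt (s u : seq bool) : R :=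
  match s, u with
  | _, [::] => 1
  | [::], _ => 2^-1 ^+ size u
  | a :: s', b :: u' => if a == b then relative_wt s' u' else 0
  end%R.

Lemma relative_wt_nil u : relative_wt [::] u = (2^-1 ^+ size u)%R.
Proof. by case: u. Qed.

Lemma relative_wt_refl s : relative_wt s s = 1%R.
Proof. by elim: s => //= a s; rewrite eqxx. Qed.

Lemma relative_wt_ge0 s u : 0 <= (relative_wt s u)%:E.
Proof.
rewrite lee_fin; elim: s u => [|a s IH] [|b u] //=.
by case: ifP.
Qed.

Lemma relative_wt_split s u : (relative_wt (rcons s false) u +
  relative_wt (rcons s true) u = 2 * relative_wt s u)%R.
Proof.
elim: s u => [|a s IH] [|b u] /=; rewrite ?relative_wt_nil; [lra| |lra|].
  have := relative_wt_nil u; rewrite /relative_wt => ->.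
  by rewrite exprS; case: b => /=; field.
by case: ifP => // _; rewrite addr0 mulr0.
Qed.

(** A sequence of cylinders of total weight below 1 misses a point.  The total
    share [W u] of the cylinder of [u] that they cover, with multiplicity, is
    the mean of the shares for its two children, so some branch keeps it below
    1 forever; a point of the cylinder of [s k] would have share at least 1 at
    the level of [s k]. *)
Lemma cantor_outerT_neq0 : cantor_outer R setT != 0.
Proof.
suff : 1 <= cantor_outer R setT.
  by apply: contraTneq => ->; rewrite lee_fin ler10.
apply: le_ereal_inf_tmp => _ [s s_cover <-]; rewrite leNgt; apply/negP => s_lt1.
pose W u := \sum_(k <oo) (relative_wt u (s k))%:E.
have W_child u : W u < 1 -> exists b, W (rcons u b) < 1.
  move=> Wu; apply: contrapT => /forallNP nW.
  have W1 b : 1 <= W (rcons u b) by rewrite leNgt; apply/negP/nW.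
  have : 2%:E <= W (rcons u false) + W (rcons u true).
    by rewrite (_ : 2%:E = 1 + 1)// leeD.
  rewrite /W -nneseriesD; [|by move=> *; exact: relative_wt_ge0..].
  under eq_eseriesr do rewrite -EFinD relative_wt_split EFinM.
  rewrite nneseriesZl; last by move=> *; exact: relative_wt_ge0.
  rewrite -/(W u) => W2.
  have : 2%:E * W u < 2%:E * 1 by rewrite lte_pmul2l.
  by rewrite mule1 ltNge W2.
have [next nextP] : {next : seq bool -> bool &
    forall u, W u < 1 -> W (rcons u (next u)) < 1}.
  apply: (@choice _ _ (fun u b => W u < 1 -> W (rcons u b) < 1)) => u.
  have [/W_child[b Wb]|W1] := pselect (W u < 1); first by exists b.
  by exists true.
pose branch := fix branch n :=
  if n is n'.+1 then rcons (branch n') (next (branch n')) else [::].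
have branch_lt n : W (branch n) < 1.
  elim: n => [|n IH] /=; last exact: nextP.
  apply: le_lt_trans s_lt1; rewrite le_eqVlt; apply/orP; left; apply/eqP.
  by apply: eq_eseriesr => k _; rewrite relative_wt_nil.
pose x : cantor_space := fun n => next (branch n).
have branchE n : branch n = restr x n.
  elim: n => //= n IH; rewrite {1}IH /restr /mkseq -[in RHS]addn1 iotaD map_cat.
  by rewrite cats1.
have [k _ xk] := s_cover x Logic.I.
have := branch_lt (size (s k)); rewrite branchE xk ltNge.
suff -> : 1 <= W (s k) by [].
rewrite -(relative_wt_refl (s k)) /W.
apply: le_trans (nneseries_lim_ge k.+1 _) => [|*]; last exact: relative_wt_ge0.
rewrite big_nat_recr//= leeDr//.
by apply: sume_ge0 => n _; exact: relative_wt_ge0.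
Qed.

End full_measure.

(** * A perfect set transversal to the codes *)

Definition even_zero : set cantor_space := [set x | forall k, x k.*2 = false].

Lemma even_zero_perfect : perfect even_zero.
Proof.
have cl : closed even_zero.
  rewrite (_ : even_zero =
      \bigcap_k (fun x : cantor_space => x k.*2) @^-1` [set false]).
    apply: closed_bigI => k _; apply: closed_comp; last exact: discrete_closed.
    by move=> x _; exact: continuous_bit.
  by apply/seteqP; split => x xz k; [move=> _; exact: xz|exact: xz].
split; first by exists (fun=> false).
split => //; apply/seteqP; split.
  by rewrite [X in _ `<=` X](closure_id _).1//; exact: subset_limit_point.
move=> x xz U /cylinder_basis[n nU].
(* Flipping a late odd bit gives other points of the set near x. *)
exists (fun k => if k == n.*2.+1 then ~~ x k else x k); split.
- apply/eqP => /(congr1 (fun y : cantor_space => y n.*2.+1)).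
  by rewrite eqxx; case: (x _).
- move=> k /=; case: eqP => // /(congr1 odd).
  by rewrite /= !odd_double.
- apply: nU; apply/cylinder_restrP => k kn.
  case: eqP kn => // ->; rewrite ltnNge; apply: contraNeq => _.
  by rewrite -addnn -addSn leq_addl.
Qed.

(** Every word [shortest_split even_zero v] is empty (the default value, if
    there is no splitting node above [v]) or belongs to the tree, so it has no
    true bit at an even place, and neither has the union of such words. *)
Lemma canon_homeo_even_zero x : even_zero (canon_homeo even_zero x).
Proof.
move=> k; apply/negbTE/negP => /asboolP[n].
have tree_even w : tree even_zero w -> onth w k.*2 <> Some true.
  move=> [y [m [yz ->]]] onthk.
  have km : (k.*2 < m)%N.
    by have := onthTE (restr y m) k.*2; rewrite onthk size_mkseq => <-.
  by have := @onth_nth _ false _ _ _ onthk; rewrite nth_restr// yz.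
have split_even v : onth (shortest_split even_zero v) k.*2 <> Some true.
  rewrite /shortest_split; case: xgetP => [w _ [[tw _ _] _ _]|_].
    exact: tree_even tw.
  by rewrite onth0n.
rewrite /canon_iso; case/lastP: (restr x n) => [|w b]; rewrite ?foldl_rcons;
  exact: split_even.
Qed.

Lemma exists_outside_P_null (R : realType) (A : set cantor_space) :
  P_null R even_zero A -> exists2 p, even_zero p & ~ A p.
Proof.
move=> [AP _ A0]; apply: contrapT => noP.
have AE : A = even_zero.
  apply/seteqP; split => // p Pp; apply: contrapT => nAp.
  by apply: noP; exists p.
move/eqP: A0; rewrite AE /canon_measure (_ : _ @^-1` _ = setT); last first.
  by apply/seteqP; split => // x _; exact: canon_homeo_even_zero.
by apply/negP; exact: cantor_outerT_neq0.
Qed.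

(** * The theorem *)

Theorem corollary3p8 (R : realType) :
  non_null_card_eq R [set: nat -> bool] -> PN' R <> UN R.
Proof.
move=> [A [Anull Amin Acard]].
have [lt [tri seg]] := small_initial_segments A.
have [f fsurj] : exists f : R -> nat -> bool,
    forall c, exists2 a, A a & f a = c.
  move: Acard; rewrite card_eq_le => /andP[_ /pcard_geP[f]].
  by exists f => c; have [a Aa <-] := @surj _ _ _ _ f c Logic.I; exists a.
have codeP a : exists c, A a ->
    lebesgue_measure (decode (@rat_itv R) c) = 0%E /\
    (forall b, A b -> lt b a -> decode (@rat_itv R) c b).
  have [Aa|nAa] := pselect (A a); last by exists (fun=> false).
  have segnull : lebesgue_measure.-negligible [set b | A b /\ lt b a].
    by apply: contrapT => /Amin; exact: seg.
  have [F [oF segF F0]] := outer_measure_Gdelta [set b | A b /\ lt b a].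
  have [c cE] := decode_surj (@rat_itv_open_basis R) oF.
  exists c => _; rewrite -cE; split => [|b Ab ba]; last exact: segF.
  rewrite F0; exact/negligible_outer_measure.
have [c cP] := choice codeP.
pose t a : cantor_space := fun k => if odd k then false else c a k./2.
pose G a := decode cylinder (f a).
have pP a : exists p, even_zero p /\
    (P_null R even_zero (translate (G a) (t a) `&` even_zero) ->
     ~ translate (G a) (t a) p).
  have [nullG|] := pselect
      (P_null R even_zero (translate (G a) (t a) `&` even_zero)).
    have [p Pp np] := exists_outside_P_null nullG.
    by exists p; split => // _ Gp; apply: np; split.
  by move=> nn; exists (fun=> false); split.
have [p pP'] := choice pP.
pose x a : cantor_space := fun k => addb (p a k) (t a k).
have xE a : evens (x a) = c a.
  apply/funext => k; rewrite /evens /x /t odd_double doubleK.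
  by rewrite (pP' a).1.
have xUN : UN R (x @` A).
  apply: (UN_of_covering_codes Anull Amin tri seg) => [a Aa|a b Aa Ab ba];
    rewrite xE.
    exact: (cP a Aa).1.
  exact: (cP a Aa).2.
move=> PNUN.
have /(_ _ even_zero_perfect)[_ [[F oF ->] FX Fnull]] : PN' R (x @` A).
  by rewrite PNUN.
have [d dE] := decode_surj cylinder_open_basis oF.
have [a Aa fa] := fsurj d.
(* G a contains x a = p a + t a, so its translate by t a contains p a. *)
apply: (pP' a).2; rewrite /G fa -dE; first exact: Fnull.
exists (x a); first by apply: FX; exists a.
by apply/funext => k; rewrite /x addbK.
Qed.
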